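(* The frequency difference of arrival between receivers $i$ and $j$, $f_{i,j}$, satisfies $$|f_{i,j}|\le \|\mathbf{v}_j\|+\|\mathbf{v}_i\|,$$ where $\mathbf{v}_i$ and $\mathbf{v}_j$ are the velocity vectors of receivers $i$ and $j$, respectively.
   Context: A radio-frequency emitter is located at $\mathbf{x}\in\mathbb{R}^3$. Receivers $i$ and $j$ have known locations $\mathbf{x}_i,\mathbf{x}_j\in\mathbb{R}^3$ (different from $\mathbf{x}$) and velocity vectors $\mathbf{v}_i,\mathbf{v}_j\in\mathbb{R}^3$. The frequency difference of arrival (FDOA) between receiver $i$ and receiver $j$ is $$f_{i,j}=\frac{f_0}{c}\left[\frac{\mathbf{v}_i^T(\mathbf{x}_i-\mathbf{x})}{\|\mathbf{x}_i-\mathbf{x}\|}-\frac{\mathbf{v}_j^T(\mathbf{x}_j-\mathbf{x})}{\|\mathbf{x}_j-\mathbf{x}\|}\right],$$ where $f_0$ is the emitted frequency, $c$ is the speed of propagation, and $\|\cdot\|$ is the Euclidean norm.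
   Formalization: The formal statement adds f_0 ≤ c (with f_0, c > 0), since the bound has no factor f_0/c and fails when f_0 > c: for x = 0, x_i = v_i = v_j = e_1, x_j = −e_1 one gets |f_{i,j}| = 2f_0/c, while the bound is 2. *)

(* Defs.v *)
From mathcomp Require Import all_boot all_order all_algebra.
From mathcomp Require Import reals.

Set Implicit Arguments.
Unset Strict Implicit.
Unset Printing Implicit Defensive.

Import Order.TTheory GRing.Theory Num.Theory.
Local Open Scope ring_scope.

(* The norm `|v| that MathComp-Analysis puts on matrices is the sup norm, hence
   a separate definition of the Euclidean one. *)
Definition enorm (R : realType) (n : nat) (v : 'cV[R]_n) : R :=
  Num.sqrt (\sum_(k < n) v k ord0 ^+ 2).

(* The velocity of a receiver at [y] projected on the unit vector pointing
   from the emitter [x] to [y]; v^T (y - x) is a 1 x 1 matrix, of which we take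
   the entry. *)
Definition radial_velocity (R : realType) (x y v : 'cV[R]_3) : R :=
  (v^T *m (y - x)) ord0 ord0 / enorm (y - x).

Definition fdoa (R : realType) (f0 c : R) (x xi xj vi vj : 'cV[R]_3) : R :=
  f0 / c * (radial_velocity x xi vi - radial_velocity x xj vj).

(* Main.v *)
Require Import Defs.
From mathcomp Require Import all_boot all_order all_algebra.
From mathcomp Require Import reals.
From mathcomp Require Import ring.

Set Implicit Arguments.
Unset Strict Implicit.
Unset Printing Implicit Defensive.

Import Order.TTheory GRing.Theory Num.Theory.
Local Open Scope ring_scope.

Lemma sum_CauchySchwarz (R : realDomainType) (I : finType) (a b : I -> R) :
  (\sum_i a i * b i) ^+ 2 <= (\sum_i a i ^+ 2) * (\sum_i b i ^+ 2).
Proof.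
(* Doubling lets the sum of squares run over all ordered pairs, each unordered pair counted twice,
   with no order on [I] and no division in [R]. *)
rewrite -subr_ge0 -(pmulrn_lge0 _ (ltn0Sn 1)).
(* Lagrange's identity. *)
suff -> : ((\sum_i a i ^+ 2) * (\sum_i b i ^+ 2) - (\sum_i a i * b i) ^+ 2) *+ 2
    = \sum_i \sum_j (a i * b j - a j * b i) ^+ 2.
  by apply: sumr_ge0 => i _; apply: sumr_ge0 => j _; apply: sqr_ge0.
(* Each term is grouped as a factor in [i] times a factor in [j], so that the double sums split into
   products. *)
have expand i j : (a i * b j - a j * b i) ^+ 2 =
    a i ^+ 2 * b j ^+ 2 + b i ^+ 2 * a j ^+ 2
    - (a i * b i * (a j * b j)) *+ 2 by ring.
under [RHS]eq_bigr do under eq_bigr do rewrite expand.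
under [RHS]eq_bigr do
  rewrite sumrB big_split /= sumrMnl -!mulr_sumr.
rewrite sumrB big_split /= sumrMnl -!mulr_suml.
ring.
Qed.

Lemma enorm_ge0 (R : realType) (n : nat) (v : 'cV[R]_n) : 0 <= enorm v.
Proof. exact: sqrtr_ge0. Qed.

Lemma dot_le_enorm (R : realType) (n : nat) (u v : 'cV[R]_n) :
  `|(u^T *m v) ord0 ord0| <= enorm u * enorm v.
Proof.
rewrite /enorm -sqrtrM; last by apply: sumr_ge0 => i _; apply: sqr_ge0.
rewrite -sqrtr_sqr ler_wsqrtr // mxE.
under eq_bigr do rewrite mxE.
exact: sum_CauchySchwarz.
Qed.

(** By Cauchy-Schwarz, projecting on a unit vector does not lengthen [v]. *)
Lemma radial_velocity_le (R : realType) (x y v : 'cV[R]_3) :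
  `|radial_velocity x y v| <= enorm v.
Proof.
rewrite /radial_velocity normrM normfV (ger0_norm (enorm_ge0 _)).
(* The inverse of 0 is 0 by convention, so a zero distance gives radial velocity 0. *)
have [->|d_neq0] := eqVneq (enorm (y - x)) 0.
  by rewrite invr0 mulr0 enorm_ge0.
by rewrite ler_pdivrMr ?dot_le_enorm // lt_def d_neq0 enorm_ge0.
Qed.

(* The bound carries no factor f0 / c, so it presupposes frequencies normalized
   by f0 / c.  [f0 <= c] contains the normalized case f0 = c and is the weakest
   condition on f0, c > 0 under which the bound holds for all configurations. *)
Theorem mainTheorem1 (R : realType) (f0 c : R) (x xi xj vi vj : 'cV[R]_3)
    (f0_gt0 : 0 < f0) (c_gt0 : 0 < c) (f0_le_c : f0 <= c)
    (xi_neq_x : xi != x) (xj_neq_x : xj != x) :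
  `|fdoa f0 c x xi xj vi vj| <= enorm vj + enorm vi.
Proof.
rewrite /fdoa normrM ger0_norm; last by rewrite divr_ge0 // ltW.
(* Since [f0 / c] is at most 1, dropping it only enlarges the value; the triangle inequality then
   separates the receivers. *)
apply: (@le_trans _ _ `|radial_velocity x xi vi - radial_velocity x xj vj|).
  by rewrite ler_piMl // ler_pdivrMr // mul1r.
by rewrite [leRHS]addrC (le_trans (ler_normB _ _)) // lerD // radial_velocity_le.
Qed.
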